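(* Let $f_H$ be convex and $L_H$-smooth relative to the (strictly) convex function $\varphi_H$ on $C_H^k$, with $L_H>0$, and let $\tau_H\in(0,L_H^{-1}]$. Suppose that in the $k$-th iteration of the two-level BPGD algorithm (described in the context) a coarse correction is triggered and that the coarse update direction satisfies $x_H^{m,k}-x_H^{0,k}\in\operatorname{rg}(R)$, where $\operatorname{rg}(R)$ is the range of $R$. Then the coarse correction direction $d^k:=P(x_H^{m,k}-x_H^{0,k})$ is a descent direction of $f$ at $x^k$, i.e. $\langle\nabla f(x^k),d^k\rangle<0$.
   Context: $\operatorname{int}$ denotes the interior (relative interior if the set has empty interior). $C\subseteq\mathbb{R}^n$ is closed and convex, and $f:C\to\mathbb{R}$ is convex and differentiable. Bregman divergence: $D_\varphi(x,y)=\varphi(x)-\varphi(y)-\langle\nabla\varphi(y),x-y\rangle$. A function $g$ is $L$-smooth relative to $\varphi$ on a convex set $K$ if $D_g(x,y)\le L D_\varphi(x,y)$ for all $x\in K$, $y\in\operatorname{int}K$. Transfer operators: linear maps $R:\mathbb{R}^n\to\mathbb{R}^{n_H}$ and $P:\mathbb{R}^{n_H}\to\mathbb{R}^n$ with $R=P^\top$. Coarse model at iteration $k$, given $x^k\in\operatorname{int}C$: $f_H:\mathbb{R}^{n_H}\to(-\infty,\infty]$ is convex and differentiable where needed, and $\psi^k(x)=f_H(x)+\langle v^k,x-Rx^k\rangle$ with $v^k=R\nabla f(x^k)-\nabla f_H(Rx^k)$. The coarse constraint set $C_H^k\subseteq\mathbb{R}^{n_H}$ is closed and convex, $C_H^k\subseteq\{w\in\mathbb{R}^{n_H}:x^k+P(w-Rx^k)\in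 C\}$, and $Rx^k\in\operatorname{int}C_H^k$. The reference function $\varphi_H:\mathbb{R}^{n_H}\to(-\infty,\infty]$ is convex, strictly convex on $C_H^k$, and differentiable on $\operatorname{int}\operatorname{dom}\varphi_H\supseteq\operatorname{int}C_H^k$. Coarse part of the two-level BPGD algorithm in iteration $k$: $x_H^{0,k}=Rx^k$, and for $i=1,\dots,m$ ($m\ge1$), $x_H^{i,k}=\arg\min_{u\in C_H^k}\{\tau_H\langle\nabla\psi^k(x_H^{i-1,k}),u-x_H^{i-1,k}\rangle+D_{\varphi_H}(u,x_H^{i-1,k})\}$; these subproblems are assumed to have unique solutions, lying in $\operatorname{int}C_H^k$. A coarse correction is triggered at $x^k$ only if the following coarse correction criterion holds for fixed $\kappa,\epsilon\in(0,1)$: $$\Big|\min_{x_H^{0,k}+d\in C_H^k}\langle\nabla\psi^k(x_H^{0,k}),d\rangle\Big|\ \ge\ \kappa\,\Big|\min_{x^k+d\in C}\langle\nabla f(x^k),d\rangle\Big|\ \ge\ \epsilon .$$ (The algorithm additionally requires that $x^k$ be at Bregman distance at least $\epsilon_x>0$ from the last iterate $\widetilde x$ that triggered a coarse correction, i.e. $D_\varphi(x^k,\widetilde x)\ge\epsilon_x$ for the fine-level reference function $\varphi$.) *)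

(* Defs.v *)
From HB Require Import structures.
From mathcomp Require Import all_boot all_order all_algebra.
From mathcomp Require Import all_classical all_reals all_analysis.

Set Implicit Arguments.
Unset Strict Implicit.
Unset Printing Implicit Defensive.

Import Order.TTheory GRing.Theory Num.Theory.
Import numFieldNormedType.Exports.

Local Open Scope classical_set_scope.
Local Open Scope ring_scope.

Section Defs.
Context {R : realType}.

Definition dot n (u v : 'cV[R]_n) : R := \sum_i u i 0 * v i 0.

Definition affine_hull n (C : set 'cV[R]_n) : set 'cV[R]_n :=
  [set y | exists k (p : 'I_k -> 'cV[R]_n) (c : 'I_k -> R),
    [/\ forall i, C (p i), \sum_i c i = 1 & y = \sum_i c i *: p i]].

Definition relative_interior n (C : set 'cV[R]_n) : set 'cV[R]_n :=
  [set x | C x /\ \forall y \near x, affine_hull C y -> C y].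

(* The set written int C in the text. *)
Definition cvx_interior n (C : set 'cV[R]_n) : set 'cV[R]_n :=
  [set x | C° x \/ (C° = set0 /\ relative_interior C x)].

Definition effective_domain n (h : 'cV[R]_n -> \bar R) : set 'cV[R]_n :=
  [set x | (h x < +oo)%E].

(* Fréchet differentiability of [h] at [x] relative to the domain [D] of [h],
   with gradient [g].  For [x] in the topological interior of [D] this is the
   usual notion and [g] is unique.  When [D] has empty interior, [g] is
   determined only up to vectors orthogonal to the affine hull of [D].  The
   sup norm of ['cV[R]_n] replaces the Euclidean one, which is immaterial. *)
Definition is_gradient_in n (D : set 'cV[R]_n) (h : 'cV[R]_n -> R)
    (x g : 'cV[R]_n) : Prop :=
  D x /\ forall e : R, 0 < e -> \forall y \near x, D y ->
    `|h y - h x - dot g (y - x)| <= e * `|y - x|.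

Definition is_gradient n (h : 'cV[R]_n -> \bar R) (x g : 'cV[R]_n) : Prop :=
  is_gradient_in (effective_domain h) (fine \o h) x g.

Definition econvex n (h : 'cV[R]_n -> \bar R) : Prop :=
  forall (x y : 'cV[R]_n) (t : R), 0 < t -> t < 1 ->
    (h (t *: x + (1 - t) *: y)%R <= t%:E * h x + (1 - t)%:E * h y)%E.

(* The strict inequality is required only between points of finite value:
   elsewhere its right-hand side is +oo and it would exclude functions that
   are +oo on part of the boundary of [C], such as the Burg entropy. *)
Definition strictly_econvex_on n (C : set 'cV[R]_n) (h : 'cV[R]_n -> \bar R) :
    Prop :=
  forall (x y : 'cV[R]_n) (t : R), C x -> C y -> x != y ->
    (h x < +oo)%E -> (h y < +oo)%E -> 0 < t -> t < 1 ->
    (h (t *: x + (1 - t) *: y)%R < t%:E * h x + (1 - t)%:E * h y)%E.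

(* In the sequel, [dh : 'cV[R]_n -> 'cV[R]_n] stands for a gradient map of
   [h]. *)
Definition bregman n (h : 'cV[R]_n -> \bar R) (dh : 'cV[R]_n -> 'cV[R]_n)
    (x y : 'cV[R]_n) : \bar R :=
  (h x - h y - (dot (dh y) (x - y)%R)%:E)%E.

Definition relatively_smooth n (L : R) (K : set 'cV[R]_n)
    (h : 'cV[R]_n -> \bar R) (dh : 'cV[R]_n -> 'cV[R]_n)
    (phi : 'cV[R]_n -> \bar R) (dphi : 'cV[R]_n -> 'cV[R]_n) : Prop :=
  forall x y, K x -> cvx_interior K y ->
    (bregman h dh x y <= L%:E * bregman phi dphi x y)%E.

Definition reference_function n (C : set 'cV[R]_n)
    (phi : 'cV[R]_n -> \bar R) (dphi : 'cV[R]_n -> 'cV[R]_n) : Prop :=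
  [/\ forall x, (-oo < phi x)%E,
      econvex phi,
      strictly_econvex_on C phi,
      cvx_interior C `<=` cvx_interior (effective_domain phi) &
      forall x, cvx_interior (effective_domain phi) x -> is_gradient phi x (dphi x)].

(* psi(w) = fH(w) + <v, w - c> *)
Definition coarse_model n (fH : 'cV[R]_n -> \bar R) (v c w : 'cV[R]_n) :
    \bar R :=
  (fH w + (dot v (w - c)%R)%:E)%E.

Definition argmin n (C : set 'cV[R]_n) (h : 'cV[R]_n -> \bar R) :
    set 'cV[R]_n :=
  [set u | C u /\ forall w, C w -> (h u <= h w)%E].

Definition bpgd_objective n (tau : R) (g : 'cV[R]_n)
    (phi : 'cV[R]_n -> \bar R) (dphi : 'cV[R]_n -> 'cV[R]_n)
    (y u : 'cV[R]_n) : \bar R :=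
  ((tau * dot g (u - y)%R)%:E + bregman phi dphi u y)%E.

(* min of <g, d> over x + d in C, as an infimum in the extended reals, so that
   it makes sense whether or not the minimum is attained. *)
Definition min_slope n (C : set 'cV[R]_n) (g x : 'cV[R]_n) : \bar R :=
  ereal_inf [set (dot g d)%:E | d in [set d : 'cV[R]_n | C (x + d)]].

(* [g] and [gH] are the gradients of the fine objective at [x] and of the
   coarse model at [xH].  [xlast] is the last iterate that triggered a coarse
   correction, [None] if there was none so far. *)
Definition coarse_correction_triggered n nH
    (kappa eps epsx : R)
    (C : set 'cV[R]_n) (g x : 'cV[R]_n)
    (CH : set 'cV[R]_nH) (gH xH : 'cV[R]_nH)
    (phi : 'cV[R]_n -> \bar R) (dphi : 'cV[R]_n -> 'cV[R]_n)
    (xlast : option 'cV[R]_n) : Prop :=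
  [/\ (kappa%:E * `|min_slope C g x| <= `|min_slope CH gH xH|)%E,
      (eps%:E <= kappa%:E * `|min_slope C g x|)%E &
      forall xt, xlast = Some xt -> (epsx%:E <= bregman phi dphi x xt)%E].

End Defs.

(* Main.v *)
Require Import Defs.
From HB Require Import structures.
From mathcomp Require Import all_boot all_order all_algebra.
From mathcomp Require Import all_classical all_reals all_analysis.
From mathcomp Require Import ring lra.

Set Implicit Arguments.
Unset Strict Implicit.
Unset Printing Implicit Defensive.

Import Order.TTheory GRing.Theory Num.Theory.
Import numFieldNormedType.Exports.

Local Open Scope classical_set_scope.
Local Open Scope ring_scope.

(** The descent direction comes from a strict decrease of the coarse model
    [psi] along the coarse iterates [x_0, ..., x_m], where [x_0 = R x^k].

    - Since [R = P^T], [<grad f(x^k), d^k> = <R grad f(x^k), x_m - x_0>], and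
      [R grad f(x^k)] is by design of [v^k] a gradient of [psi] at [x_0]
      ([coarse_model_gradient]).  As [psi] is convex, this slope is at most
      [psi(x_m) - psi(x_0)] ([econvex_above_tangent]), so it is enough that
      [psi(x_m) < psi(x_0)].

    - Adding a linear term to [fH] leaves its Bregman divergence unchanged
      ([bregman_coarse_model]), so [psi] inherits relative smoothness from
      [fH].  With [tau <= 1/L] the step objective at [u] then dominates
      [tau (psi(u) - psi(x_i))] ([bpgd_sufficient_decrease]).  The objective
      vanishes at [u = x_i], so its minimal value is nonpositive and no step
      increases [psi].

    - The first step decreases [psi] strictly.  Otherwise the objective would
      have minimal value 0, attained at [x_0] itself, and letting [u] tend to
      [x_0] along segments of the constraint set would show that [x_0] is
      stationary for [psi] ([bpgd_fixed_point_stationary]).  The minimal coarse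
      slope would then be 0 ([min_slope_stationary]), below the threshold
      [eps > 0] of the triggering criterion.

    Gradients are taken relative to effective domains, which may have empty
    interior or contain the base point on their boundary; two gradients at the
    same point may then differ.  All the arguments use only slopes in
    directions that enter the domain, and these are determined
    ([cvg_gradient_slope]). *)

(** * The dot product *)

Section DotProduct.
Context {R : realType}.

Lemma dotDl n (u v w : 'cV[R]_n) : dot (u + v) w = dot u w + dot v w.
Proof. by rewrite -big_split; apply: eq_bigr => i _; rewrite mxE mulrDl. Qed.

Lemma dotDr n (u v w : 'cV[R]_n) : dot u (v + w) = dot u v + dot u w.
Proof. by rewrite -big_split; apply: eq_bigr => i _; rewrite mxE mulrDr. Qed.

Lemma dotZr n (u v : 'cV[R]_n) (a : R) : dot u (a *: v) = a * dot u v.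
Proof. by rewrite mulr_sumr; apply: eq_bigr => i _; rewrite mxE mulrCA. Qed.

Lemma dotv0 n (u : 'cV[R]_n) : dot u 0 = 0.
Proof. by rewrite -(scale0r (0 : 'cV[R]_n)) dotZr mul0r. Qed.

Lemma dotBr n (u v w : 'cV[R]_n) : dot u (v - w) = dot u v - dot u w.
Proof. by rewrite dotDr -scaleN1r dotZr mulN1r. Qed.

Lemma dot_mulmx n p (A : 'M[R]_(n, p)) (u : 'cV[R]_n) (v : 'cV[R]_p) :
  dot u (A *m v) = dot (A^T *m u) v.
Proof.
have dotE q (a b : 'cV[R]_q) : dot a b = (a^T *m b) 0 0.
  by rewrite mxE; apply: eq_bigr => i _; rewrite mxE.
by rewrite !dotE trmx_mul trmxK mulmxA.
Qed.

End DotProduct.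

(** * Segments in convex sets *)

Section Rays.
Context {R : realType}.

Lemma cvg_ray n (x d : 'cV[R]_n) : x + t *: d @[t --> (0 : R)^'+] --> x.
Proof.
rewrite -[X in _ --> X]addr0 -[X in _ + X](scale0r d).
apply: cvgD; first exact: cvg_cst.
apply: cvgZr_tmp; apply: cvg_at_right_filter; exact: cvg_id.
Qed.

Lemma cvx_interiorW n (C : set 'cV[R]_n) : cvx_interior C `<=` C.
Proof. by move=> x [/interior_subset|[_ []]]. Qed.

(** Both kinds of interior are relatively open; this lets the arguments below
    treat them uniformly. *)
Lemma cvx_interior_near n (C : set 'cV[R]_n) (x : 'cV[R]_n) :
  cvx_interior C x -> \forall y \near x, C y -> cvx_interior C y.
Proof.
case=> [Cx|[C0 [Cx affC]]].
  by near=> y => _; left; near: y; exact: nbhs_interior.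
near=> y => Cy; right; split=> //; split=> //.
by near: y; exact: near_join affC.
Unshelve. all: by end_near. Qed.

Lemma convex_set_segment n (C : set 'cV[R]_n) (x y : 'cV[R]_n) (t : R) :
  convex_set C -> C x -> C y -> 0 <= t -> t <= 1 -> C (x + t *: (y - x)).
Proof.
move=> cC Cx Cy t0 t1.
have := cC y x (Itv01 t0 t1); rewrite !inE => /(_ Cy Cx).
rewrite /conv/= /unstable.onem scalerBl scale1r addrCA -scalerBr; exact.
Qed.

(** Endpoints of feasible segments may lie outside the domain of the reference
    function, but the points close to an interior origin do not. *)
Lemma cvx_interior_ray n (C : set 'cV[R]_n) (x y : 'cV[R]_n) :
  convex_set C -> cvx_interior C x -> C y ->
  \forall t \near (0 : R)^'+, cvx_interior C (x + t *: (y - x)).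
Proof.
move=> cC xC Cy.
have /(@cvg_ray _ x (y - x)) := cvx_interior_near xC.
move=> nC; near=> t.
have intC : C (x + t *: (y - x)) -> cvx_interior C (x + t *: (y - x)).
  by near: t; exact: nC.
apply: intC; apply: convex_set_segment => //; first exact: cvx_interiorW.
by near: t; apply: nbhs_right_le.
Unshelve. all: by end_near. Qed.

End Rays.

(** * Slopes, gradients and convexity *)

Section Gradients.
Context {R : realType}.

(** The one-sided directional derivative is all that a gradient relative to a
    domain determines; every later use of differentiability goes through this
    limit. *)
Lemma cvg_gradient_slope n (D : set 'cV[R]_n) (h : 'cV[R]_n -> R)
    (x g d : 'cV[R]_n) :
  is_gradient_in D h x g -> (\forall t \near (0 : R)^'+, D (x + t *: d)) ->
  t^-1 * (h (x + t *: d) - h x) @[t --> (0 : R)^'+] --> dot g d.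
Proof.
move=> [_ hg] Dray; apply/cvgrPdist_le => e e0.
(* The tolerance is divided by [`|d| + 1] instead of [`|d|], since [d] may
   vanish. *)
have d1 : 0 < `|d| + 1 by rewrite ltr_wpDl.
have /(@cvg_ray _ _ x d) nh := hg _ (divr_gt0 e0 d1).
near=> t; have t0 : 0 < t by near: t; exact: nbhs_right_gt.
have Dt : D (x + t *: d) by near: t.
have : `|h (x + t *: d) - h x - dot g (x + t *: d - x)| <=
    e / (`|d| + 1) * `|x + t *: d - x|.
  by move: Dt; near: t.
rewrite [x + _ - x]addrAC subrr add0r dotZr normrZ gtr0_norm// => le_h.
have -> : dot g d - t^-1 * (h (x + t *: d) - h x) =
    - t^-1 * (h (x + t *: d) - h x - t * dot g d).
  by field; rewrite gt_eqF.
rewrite mulNr normrN normrM gtr0_norm ?invr_gt0// mulrC ler_pdivrMr//.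
apply: (le_trans le_h); rewrite mulrCA mulrC ler_pM2r// -mulrA.
by rewrite ler_piMr ?(ltW e0)// mulrC ler_pdivrMr// mul1r lerDl.
Unshelve. all: by end_near. Qed.

Lemma gradient_unique_along n (D : set 'cV[R]_n) (h : 'cV[R]_n -> R)
    (x g g' d : 'cV[R]_n) :
  is_gradient_in D h x g -> is_gradient_in D h x g' ->
  (\forall t \near (0 : R)^'+, D (x + t *: d)) -> dot g d = dot g' d.
Proof.
move=> hg hg' Dray.
exact: (cvg_unique (@norm_hausdorff _ R^o)
  (cvg_gradient_slope hg Dray) (cvg_gradient_slope hg' Dray)).
Qed.

Lemma econvex_segment n (h : 'cV[R]_n -> \bar R) (x y : 'cV[R]_n) (t : R) :
  (forall w, (-oo < h w)%E) -> econvex h -> (h x < +oo)%E -> (h y < +oo)%E ->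
  0 < t -> t < 1 ->
  (h (x + t *: (y - x))%R < +oo)%E /\
  fine (h (x + t *: (y - x))) - fine (h x) <= t * (fine (h y) - fine (h x)).
Proof.
move=> hp hc hx hy t0 t1; have := hc y x t t0 t1.
have -> : t *: y + (1 - t) *: x = x + t *: (y - x).
  by rewrite scalerBl scale1r addrCA -scalerBr.
have fin w : (h w < +oo)%E -> h w = (fine (h w))%:E.
  by move=> hw; rewrite fineK// fin_real// hp.
rewrite (fin _ hx) (fin _ hy) -!EFinM -EFinD => le_h.
have hz := le_lt_trans le_h (ltry _); split=> //.
by move: le_h; rewrite (fin _ hz) lee_fin /=; lra.
Qed.

Lemma effective_domain_ray n (h : 'cV[R]_n -> \bar R) (x y : 'cV[R]_n) :
  (forall w, (-oo < h w)%E) -> econvex h -> (h x < +oo)%E -> (h y < +oo)%E ->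
  \forall t \near (0 : R)^'+, effective_domain h (x + t *: (y - x)).
Proof.
move=> hp hc hx hy; near=> t.
by have [] := @econvex_segment _ h x y t hp hc hx hy _ _.
Unshelve. all: by end_near. Qed.

(** By convexity the difference quotients of [h] from [x] towards [y] are all
    at most [h y - h x], hence so is their limit. *)
Lemma econvex_above_tangent n (h : 'cV[R]_n -> \bar R) (x y g : 'cV[R]_n) :
  (forall w, (-oo < h w)%E) -> econvex h -> is_gradient h x g ->
  (h y < +oo)%E -> dot g (y - x) <= fine (h y) - fine (h x).
Proof.
move=> hp hc hg hy; have hx : (h x < +oo)%E := hg.1.
apply: (cvgr_to_le (cvg_gradient_slope hg (effective_domain_ray hp hc hx hy))).
near=> t; have t0 : 0 < t by [].
rewrite mulrC ler_pdivrMr// [leRHS]mulrC.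
by apply: (econvex_segment hp hc hx hy _ _).2.
Unshelve. all: by end_near. Qed.

End Gradients.

(** * Bregman divergences and proximal gradient steps *)

Section Bregman.
Context {R : realType}.

Lemma bregman_fin n (h : 'cV[R]_n -> \bar R) (dh : 'cV[R]_n -> 'cV[R]_n)
    (x y : 'cV[R]_n) :
  (forall w, (-oo < h w)%E) -> (h x < +oo)%E -> (h y < +oo)%E ->
  bregman h dh x y = (fine (h x) - fine (h y) - dot (dh y) (x - y))%:E.
Proof.
move=> hp hx hy; rewrite /bregman.
by rewrite -(@fineK _ (h x)) ?fin_real ?hp// -(@fineK _ (h y)) ?fin_real ?hp.
Qed.

Lemma bregman_ge0 n (h : 'cV[R]_n -> \bar R) (dh : 'cV[R]_n -> 'cV[R]_n)
    (x y : 'cV[R]_n) :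
  (forall w, (-oo < h w)%E) -> econvex h -> is_gradient h y (dh y) ->
  (h x < +oo)%E -> (0 <= bregman h dh x y)%E.
Proof.
move=> hp hc hg hx; rewrite bregman_fin//; last exact: hg.1.
by rewrite lee_fin subr_ge0; exact: econvex_above_tangent.
Qed.

Lemma bpgd_objective_self n (tau : R) (g : 'cV[R]_n) (phi : 'cV[R]_n -> \bar R)
    (dphi : 'cV[R]_n -> 'cV[R]_n) (y : 'cV[R]_n) :
  (forall w, (-oo < phi w)%E) -> (phi y < +oo)%E ->
  bpgd_objective tau g phi dphi y y = 0%E.
Proof.
move=> pp py; rewrite /bpgd_objective bregman_fin// (subrr y) !dotv0.
by rewrite subrr mulr0 subr0 -EFinD addr0.
Qed.

(** Relative smoothness bounds [h u - h y] by its linear part plus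
    [L * D_phi(u, y)].  After multiplication by [tau], the factor [tau * L <= 1]
    can be dropped because [D_phi] is nonnegative. *)
Lemma bpgd_sufficient_decrease n (L tau : R) (K : set 'cV[R]_n)
    (h phi : 'cV[R]_n -> \bar R) (dh dphi : 'cV[R]_n -> 'cV[R]_n)
    (y u : 'cV[R]_n) :
  0 < L -> 0 < tau -> tau <= L^-1 -> relatively_smooth L K h dh phi dphi ->
  (forall w, (-oo < h w)%E) -> (h y < +oo)%E -> (h u < +oo)%E ->
  (forall w, (-oo < phi w)%E) -> econvex phi -> is_gradient phi y (dphi y) ->
  (phi u < +oo)%E -> cvx_interior K y -> K u ->
  ((tau * (fine (h u) - fine (h y)))%:E <=
     bpgd_objective tau (dh y) phi dphi y u)%E.
Proof.
move=> L0 tau0 tauL smooth hp hy hu pp pc pg pu Ky Ku.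
have py : (phi y < +oo)%E := pg.1.
have := smooth u y Ku Ky; have := bregman_ge0 pp pc pg pu.
rewrite /bpgd_objective !bregman_fin// -EFinM !lee_fin => D0 le_D.
set Dh := fine (h u) - _ - _ in le_D; set Dphi := fine (phi u) - _ - _ in D0 le_D *.
have -> : fine (h u) - fine (h y) = dot (dh y) (u - y) + Dh by rewrite /Dh; ring.
rewrite mulrDr lerD2l; apply: (le_trans (ler_wpM2l (ltW tau0) le_D)).
by rewrite mulrA ler_piMl// -ler_pdivlMr// mul1r.
Qed.

(** The divergence [D_phi(., y)] has zero slope at [y], so at a minimizer [y]
    the nonnegative slopes of the objective are those of its linear part. *)
Lemma bpgd_fixed_point_stationary n (tau : R) (g : 'cV[R]_n) (K : set 'cV[R]_n)
    (phi : 'cV[R]_n -> \bar R) (dphi : 'cV[R]_n -> 'cV[R]_n)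
    (y w : 'cV[R]_n) :
  0 < tau -> convex_set K -> reference_function K phi dphi ->
  cvx_interior K y -> argmin K (bpgd_objective tau g phi dphi y) y ->
  K w -> 0 <= dot g (w - y).
Proof.
move=> tau0 cK [pp pc _ Kphi pg] Ky [_ ymin] Kw.
have fin z : cvx_interior K z -> (phi z < +oo)%E.
  by move=> /Kphi /cvx_interiorW.
have Kray := cvx_interior_ray cK Ky Kw.
have Dray : \forall t \near (0 : R)^'+, effective_domain phi (y + t *: (w - y)).
  by near=> t; apply: fin; near: t.
have slope := cvg_gradient_slope (pg _ (Kphi _ Ky)) Dray.
(* Minimality at [y] bounds the difference quotients of [phi] from below by the
   left-hand side, which is then a lower bound of their limit. *)
suff : dot (dphi y) (w - y) - tau * dot g (w - y) <= dot (dphi y) (w - y).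
  by rewrite gerBl pmulr_rge0.
apply: (cvgr_to_ge slope); near=> t.
have t0 : 0 < t by [].
have Kz : cvx_interior K (y + t *: (w - y)) by near: t.
have := ymin _ (cvx_interiorW Kz).
rewrite bpgd_objective_self ?fin// /bpgd_objective bregman_fin ?fin//.
rewrite [y + _ - y]addrAC subrr add0r !dotZr -EFinD lee_fin => obj0.
by rewrite [leRHS]mulrC ler_pdivlMr//=; move: obj0; lra.
Unshelve. all: by end_near. Qed.

Lemma min_slope_stationary n (C : set 'cV[R]_n) (g x : 'cV[R]_n) :
  C x -> (forall w, C w -> 0 <= dot g (w - x)) -> min_slope C g x = 0%E.
Proof.
move=> Cx g0; apply/eqP; rewrite eq_le; apply/andP; split.
  by apply: ereal_inf_lbound; exists 0; rewrite /= ?addr0 ?dotv0.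
apply/ereal_infP => _ [d /= Cd <-]; rewrite lee_fin.
by have := g0 _ Cd; rewrite addrAC subrr add0r.
Qed.

End Bregman.

(** * The coarse model *)

Section CoarseModel.
Context {R : realType} (n : nat) (fH : 'cV[R]_n -> \bar R) (v c : 'cV[R]_n).
Local Notation psi := (coarse_model fH v c).

Lemma coarse_model_gtNy : (forall w, (-oo < fH w)%E) ->
  forall w, (-oo < psi w)%E.
Proof.
by move=> fp w; rewrite /coarse_model; case: (fH w) (fp w) => [r| |]; rewrite ?ltNyr.
Qed.

Lemma coarse_model_lty w : (psi w < +oo)%E = (fH w < +oo)%E.
Proof. by rewrite /coarse_model; case: (fH w) => [r| |]; rewrite ?ltry. Qed.

Lemma coarse_model_econvex : (forall w, (-oo < fH w)%E) ->
  econvex fH -> econvex psi.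
Proof.
move=> fp fc x y t t0 t1; rewrite /coarse_model.
have -> : dot v (t *: x + (1 - t) *: y - c) =
    t * dot v (x - c) + (1 - t) * dot v (y - c).
  by rewrite !dotBr dotDr !dotZr; ring.
rewrite !muleDr ?fin_num_adde_defl// -!EFinM.
rewrite [leRHS]addeACA -EFinD leeD2r//; exact: fc.
Qed.

Lemma coarse_model_gradient w g : (forall w, (-oo < fH w)%E) ->
  is_gradient fH w g -> is_gradient psi w (g + v).
Proof.
move=> fp [fw hg]; split=> [|e e0]; first by rewrite /effective_domain/= coarse_model_lty.
have nh := hg e e0.
near=> y; rewrite /effective_domain/= coarse_model_lty => fy.
have fineE z : (fH z < +oo)%E -> fine (psi z) = fine (fH z) + dot v (z - c).
  by move=> fz; rewrite /coarse_model fineD// fin_real// fp.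
rewrite !fineE//.
have -> : fine (fH y) + dot v (y - c) - (fine (fH w) + dot v (w - c)) -
   dot (g + v) (y - w) = fine (fH y) - fine (fH w) - dot g (y - w).
  by rewrite dotDl !dotBr; ring.
by move: fy; near: y.
Unshelve. all: by end_near. Qed.

(** The linear term cancels in the divergence.  The given gradient [dpsi y] need
    not be [dfH y + v], but it has the same slope towards each point of the
    domain; outside the domain both divergences are infinite. *)
Lemma bregman_coarse_model (dfH dpsi : 'cV[R]_n -> 'cV[R]_n) (x y : 'cV[R]_n) :
  (forall w, (-oo < fH w)%E) -> econvex fH -> is_gradient fH y (dfH y) ->
  is_gradient psi y (dpsi y) -> bregman psi dpsi x y = bregman fH dfH x y.
Proof.
move=> fp fc gf gpsi; have fy : (fH y < +oo)%E := gf.1.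
have pp := coarse_model_gtNy fp.
have py : (psi y < +oo)%E by rewrite coarse_model_lty.
have [fx|] := boolP (fH x < +oo)%E; last first.
  rewrite ltey negbK => /eqP fx; rewrite /bregman /coarse_model fx.
  by rewrite -(@fineK _ (fH y)) ?fin_real ?fp.
have px : (psi x < +oo)%E by rewrite coarse_model_lty.
have -> : bregman psi dpsi x y = bregman psi (fun z => dfH z + v) x y.
  rewrite !bregman_fin//; congr (_ - _)%:E.
  apply: (gradient_unique_along gpsi (coarse_model_gradient fp gf)).
  exact: effective_domain_ray (coarse_model_econvex fp fc) _ _.
rewrite !bregman_fin// /coarse_model !fineD ?fin_real ?fp ?ltNyr ?ltry//=.
by congr _%:E; rewrite dotDl !dotBr; ring.
Qed.

End CoarseModel.

(** * The coarse correction direction *)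

Theorem proposition3p4 (R : realType) (n nH : nat)
  (* fine level: f : C -> R, with gradient map df *)
  (C : set 'cV[R]_n) (f : 'cV[R]_n -> R) (df : 'cV[R]_n -> 'cV[R]_n)
  (phi : 'cV[R]_n -> \bar R) (dphi : 'cV[R]_n -> 'cV[R]_n)
  (C_closed : closed C) (C_convex : convex_set C)
  (f_convex : convex_function C f)
  (f_diff : forall x, C x -> is_gradient_in C f x (df x))
  (phi_ref : reference_function C phi dphi)
  (* transfer operators *)
  (Rst : 'M[R]_(nH, n)) (Prl : 'M[R]_(n, nH)) (Rst_Prl : Rst = Prl^T)
  (* current iterate x^k, and last iterate that triggered a correction *)
  (xk : 'cV[R]_n) (xk_int : cvx_interior C xk)
  (xlast : option 'cV[R]_n)
  (xlast_int : forall xt, xlast = Some xt -> cvx_interior C xt)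
  (* coarse constraint set *)
  (CH : set 'cV[R]_nH)
  (CH_closed : closed CH) (CH_convex : convex_set CH)
  (CH_feasible : CH `<=` [set w | C (xk + Prl *m (w - Rst *m xk))])
  (Rxk_int : cvx_interior CH (Rst *m xk))
  (* coarse objective, reference function and coarse model *)
  (fH : 'cV[R]_nH -> \bar R) (dfH : 'cV[R]_nH -> 'cV[R]_nH)
  (phiH : 'cV[R]_nH -> \bar R) (dphiH : 'cV[R]_nH -> 'cV[R]_nH)
  (dpsi : 'cV[R]_nH -> 'cV[R]_nH)
  (fH_proper : forall w, (-oo < fH w)%E)
  (fH_convex : econvex fH)
  (fH_diff : forall w, cvx_interior CH w -> is_gradient fH w (dfH w))
  (phiH_ref : reference_function CH phiH dphiH)
  (psi := let v := Rst *m df xk - dfH (Rst *m xk) in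
          coarse_model fH v (Rst *m xk))
  (psi_diff : forall w, cvx_interior CH w -> is_gradient psi w (dpsi w))
  (LH tauH : R) (LH_gt0 : 0 < LH)
  (fH_smooth : relatively_smooth LH CH fH dfH phiH dphiH)
  (tauH_gt0 : 0 < tauH) (tauH_le : tauH <= LH^-1)
  (* coarse iterates *)
  (m : nat) (m_ge1 : (1 <= m)%N) (xH : nat -> 'cV[R]_nH)
  (xH0 : xH 0%N = Rst *m xk)
  (xHS : forall i, (i < m)%N ->
     argmin CH (bpgd_objective tauH (dpsi (xH i)) phiH dphiH (xH i))
       = [set xH i.+1])
  (xH_int : forall i, (i < m)%N -> cvx_interior CH (xH i.+1))
  (* a coarse correction is triggered at x^k *)
  (kappa eps epsx : R)
  (kappa_gt0 : 0 < kappa) (kappa_lt1 : kappa < 1)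
  (eps_gt0 : 0 < eps) (eps_lt1 : eps < 1) (epsx_gt0 : 0 < epsx)
  (triggered : coarse_correction_triggered kappa eps epsx
     C (df xk) xk CH (dpsi (xH 0%N)) (xH 0%N) phi dphi xlast)
  (xH_range : exists z : 'cV[R]_n, xH m - xH 0%N = Rst *m z) :
  let dk := Prl *m (xH m - xH 0%N) in
  dot (df xk) dk < 0.
Proof.
rewrite /= dot_mulmx -Rst_Prl; have [pp pc _ Kphi pg] := phiH_ref.
have psi_gtNy w : (-oo < psi w)%E by exact: coarse_model_gtNy.
have psi_convex : econvex psi by exact: coarse_model_econvex.
have xH_in i : (i <= m)%N -> cvx_interior CH (xH i).
  by case: i => [_|i im]; [rewrite xH0|exact: xH_int].
have psi_fin i : (i <= m)%N -> (psi (xH i) < +oo)%E.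
  by move=> /xH_in/psi_diff[].
have phi_fin i : (i <= m)%N -> (phiH (xH i) < +oo)%E.
  by move=> /xH_in/Kphi/cvx_interiorW.
have psi_smooth : relatively_smooth LH CH psi dpsi phiH dphiH.
  move=> x y Cx Cy; rewrite (bregman_coarse_model x fH_proper fH_convex
    (fH_diff _ Cy) (psi_diff _ Cy)); exact: fH_smooth.
pose obj i := bpgd_objective tauH (dpsi (xH i)) phiH dphiH (xH i).
have obj_self i : (i < m)%N -> obj i (xH i) = 0%E.
  by move=> im; rewrite /obj bpgd_objective_self// phi_fin// ltnW.
have xH_argmin i : (i < m)%N -> argmin CH (obj i) (xH i.+1).
  by move=> im; rewrite /obj xHS.
have decrease i : (i < m)%N ->
    ((tauH * (fine (psi (xH i.+1)) - fine (psi (xH i))))%:E <= obj i (xH i.+1))%E.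
  move=> im; apply: (bpgd_sufficient_decrease LH_gt0 tauH_gt0 tauH_le psi_smooth) => //.
  - exact/psi_fin/ltnW.
  - exact: psi_fin.
  - exact/pg/Kphi/xH_in/ltnW.
  - exact: phi_fin.
  - exact/xH_in/ltnW.
  - exact: (cvx_interiorW (xH_in _ im)).
have first_step : (obj 0%N (xH 1%N) < 0)%E.
  (* Otherwise [xH 0] would minimize its own step objective, and a stationary
     point cannot trigger a coarse correction. *)
  rewrite -(obj_self _ m_ge1) ltNge; apply/negP => le_obj.
  have min0 : argmin CH (obj 0%N) (xH 0%N).
    split; first exact: (cvx_interiorW (xH_in 0%N isT)).
    move=> w Cw; apply: (le_trans le_obj); exact: (xH_argmin _ m_ge1).2.
  have slope0 : min_slope CH (dpsi (xH 0%N)) (xH 0%N) = 0%E.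
    apply: min_slope_stationary; first exact: min0.1.
    by move=> w; apply: (bpgd_fixed_point_stationary tauH_gt0 CH_convex
      _ (xH_in _ _) min0).
  case: triggered => + + _; rewrite slope0 abse0 => le0 /le_trans/(_ le0).
  by rewrite lee_fin leNgt eps_gt0.
have psi_decrease i : (i < m)%N -> fine (psi (xH i.+1)) < fine (psi (xH 0%N)).
  elim: i => [m0|i IH im].
    have := le_lt_trans (decrease _ m0) first_step.
    by rewrite lte_fin pmulr_rlt0// subr_lt0.
  apply: le_lt_trans (IH (ltnW im)); have := decrease _ im.
  have : (obj i.+1 (xH i.+2) <= 0)%E.
    rewrite -(obj_self _ im); apply: (xH_argmin _ im).2.
    exact: (cvx_interiorW (xH_in _ (ltnW im))).
  move=> /[swap] /le_trans /[apply].
  by rewrite lee_fin pmulr_rle0// subr_le0.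
(* The choice of [v] replaces the gradient of [fH] at [xH 0] by the restricted
   fine gradient. *)
have psi_grad : is_gradient psi (xH 0%N) (Rst *m df xk).
  have := coarse_model_gradient (Rst *m df xk - dfH (xH 0%N)) (xH 0%N) fH_proper
    (fH_diff _ (xH_in 0%N isT)).
  by rewrite [X in is_gradient _ _ X]addrC subrK xH0.
apply: le_lt_trans
  (econvex_above_tangent psi_gtNy psi_convex psi_grad (psi_fin _ (leqnn m))) _.
rewrite subr_lt0 -(prednK m_ge1); apply: psi_decrease.
by rewrite prednK.
Qed.
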